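(* Let $m\ge 1$ be an integer. Let $\mathcal{A}$ be the set of all pairs $(R,C)$ with $R,C\subset\{1,\dots,2m\}$ and $|R|=|C|=m$, and let $\mathcal{B}$ be the set of all nonattacking arrangements of $2m^2$ pawns on a $2m\times 2m$ chessboard. Then the function $\Phi:\mathcal{A}\to\mathcal{B}$ defined in the context is a bijection.
   Context: A $p\times q$ chessboard is the grid of cells $(r,c)$ with $1\le r\le p$ (rows, numbered from top to bottom) and $1\le c\le q$ (columns, numbered from left to right). An arrangement of pawns is a set of cells, namely those occupied by a pawn (at most one pawn per cell). All pawns face the same vertical direction, and a pawn attacks the (at most two) cells diagonally adjacent to it in the neighbouring row it faces. An arrangement is nonattacking (independent) if no pawn attacks a cell occupied by another pawn; equivalently, no two occupied cells $(r,c),(r',c')$ satisfy $|r-r'|=|c-c'|=1$. Types of $2\times 2$ squares: the four nonattacking arrangements of two pawns on a $2\times 2$ board are Type A (both cells of the upper row), Type B (both cells of the right column), Type C (both cells of the lower row), Type D (both cells of the left column). Let $f$ be the function on types with $f(A)=D$ and $f(B)=f(C)=f(D)=C$. Matrix $M_{2m}$: a $2\times 2m$ board is viewed as a string, read left to right, of $m$ consecutive $2\times 2$ squares. $M_{2m}=(m_{i,j})_{1\le i,j\le m+1}$ is the matrix whose entries are the following arrangements of $2m$ pawns on a $2\times 2m$ board. For $1\le j\le m+1$, $m_{1,j}$ is the arrangement whose leftmost $m+1-j$ squares are of Type A and whose remaining rightmost $j-1$ squares are of Type B. For $1\le i\le m+1$, $m_{i,j}$ is obtained from $m_{1,j}$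 by replacing each of the leftmost $i-1$ squares by its image under $f$ and leaving the rightmost $m+1-i$ squares unchanged. Map $\Phi$: given $(R,C)\in\mathcal{A}$, write $R=\{r_1<\cdots<r_m\}$ and $C=\{c_1<\cdots<c_m\}$, and set $(a_i,b_i)=(r_i-i+1,\;c_i-i+1)$ for $1\le i\le m$. Then $\Phi(R,C)$ is the arrangement of $2m^2$ pawns on the $2m\times 2m$ board obtained by stacking the $2\times 2m$ strips $m_{a_1,b_1},\dots,m_{a_m,b_m}$ from top to bottom, with $m_{a_i,b_i}$ directly above $m_{a_{i+1},b_{i+1}}$ for $1\le i\le m-1$. *)

(* Defs.v *)
From mathcomp Require Import all_boot all_order all_algebra.

Set Implicit Arguments.
Unset Strict Implicit.
Unset Printing Implicit Defensive.

(* All indices are 0-based: row 0 is the top row, column 0 the leftmost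
   column. *)
Definition cell (p q : nat) : finType := ('I_p * 'I_q)%type.
Definition arrangement (p q : nat) : finType := {set cell p q}.

Variant facing := Upward | Downward.

Definition attacks (d : facing) (p q : nat) (x y : cell p q) : bool :=
  match d with
  | Upward => (x.1 == y.1.+1 :> nat)
  | Downward => (y.1 == x.1.+1 :> nat)
  end && ((y.2 == x.2.+1 :> nat) || (x.2 == y.2.+1 :> nat)).

Definition nonattacking (d : facing) (p q : nat) (S : arrangement p q) : bool :=
  [forall x in S, forall y in S, ~~ attacks d x y].

Variant square_type := TypeA | TypeB | TypeC | TypeD.

Definition square (t : square_type) : arrangement 2 2 :=
  match t with
  | TypeA => [set x : cell 2 2 | x.1 == 0 :> nat]
  | TypeB => [set x : cell 2 2 | x.2 == 1 :> nat]
  | TypeC => [set x : cell 2 2 | x.1 == 1 :> nat]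
  | TypeD => [set x : cell 2 2 | x.2 == 0 :> nat]
  end.

Definition type_map (t : square_type) : square_type :=
  match t with TypeA => TypeD | TypeB | TypeC | TypeD => TypeC end.

Lemma half_ord_subproof (n : nat) (k : 'I_n.*2) : k./2 < n.
Proof. by rewrite ltn_half_double. Qed.

(* The coordinate k of a board of side 2n lies in the block [half_ord k],
   at position [mod2_ord k] inside that block. *)
Definition half_ord (n : nat) (k : 'I_n.*2) : 'I_n :=
  Ordinal (half_ord_subproof k).
Definition mod2_ord (n : nat) (k : 'I_n) : 'I_2 :=
  Ordinal (ltn_pmod k (isT : 0 < 2)).

Definition string_of_squares (m : nat) (t : 'I_m -> square_type) :
    arrangement 2 m.*2 :=
  [set x : cell 2 m.*2 | (x.1, mod2_ord x.2) \in square (t (half_ord x.2))].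

Definition stack (m q : nat) (s : 'I_m -> arrangement 2 q) :
    arrangement m.*2 q :=
  [set x : cell m.*2 q | (mod2_ord x.1, x.2) \in s (half_ord x.1)].

(* With 0-based j, the number m + 1 - j of Type A squares becomes m - j and
   the number i - 1 of squares replaced by their image under type_map becomes i. *)
Definition first_row_types (m : nat) (j : 'I_m.+1) (k : 'I_m) : square_type :=
  if k < m - j then TypeA else TypeB.

Definition entry_types (m : nat) (i j : 'I_m.+1) (k : 'I_m) : square_type :=
  if k < i then type_map (first_row_types j k) else first_row_types j k.

Definition board_mx (m : nat) : 'M[arrangement 2 m.*2]_m.+1 :=
  \matrix_(i < m.+1, j < m.+1) string_of_squares (entry_types i j).

(* The i-th smallest element of R: [enum] lists ordinals in increasing
   order. *)
Definition nth_elt (n : nat) (R : {set 'I_n}) (i : nat) : nat :=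
  nth 0 [seq val r | r <- enum R] i.

(* The 0-based version of r_i - i + 1. When #|R| = m and R is a set of
   ordinals below 2m, it lies between 0 and m, so that [inord] does not
   truncate. *)
Definition shifted_index (m : nat) (R : {set 'I_m.*2}) (i : 'I_m) : 'I_m.+1 :=
  inord (nth_elt R i - i).

Definition Phi (m : nat) (RC : {set 'I_m.*2} * {set 'I_m.*2}) :
    arrangement m.*2 m.*2 :=
  stack (fun i : 'I_m => board_mx m (shifted_index RC.1 i) (shifted_index RC.2 i)).

Definition calA (m : nat) : {set {set 'I_m.*2} * {set 'I_m.*2}} :=
  [set RC : {set 'I_m.*2} * {set 'I_m.*2} |
    (#|RC.1| == m) && (#|RC.2| == m)].

Definition calB (d : facing) (m : nat) : {set arrangement m.*2 m.*2} :=
  [set S : arrangement m.*2 m.*2 | nonattacking d S && (#|S| == 2 * m ^ 2)].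

(* Main.v *)
Require Import Defs.
From mathcomp Require Import all_boot all_order all_algebra.
From mathcomp Require Import zify.

(** Cut the board into m^2 aligned 2 x 2 blocks. In a block the two cells of
    either diagonal attack each other, so a diagonal carries at most one pawn
    and a block at most two; an arrangement of 2 m^2 pawns therefore has
    exactly one pawn on each diagonal of each block. Such an arrangement is
    given by two m x m boolean matrices: P s k tells whether the main diagonal
    of block (s, k) has its pawn in the upper cell (upper left), and Q s k
    tells the same of the antidiagonal (upper right). Types A, B, C, D are the
    values (P, Q) = (1, 1), (0, 1), (0, 0), (1, 0).

    In this encoding the two diagonals decouple. Two pawns in different blocks
    that attack each other lie on diagonals of the same kind, so that
    nonattacking means: P is decreasing to the right and downwards, while Q is
    increasing to the right and decreasing downwards ([board_nonattacking],
    [board_mono]). Row s of P is then an initial run of ones, say of length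
    m - b s, and row s of Q an initial run of zeros, of length a s, and
    monotonicity in s says that a and b are weakly increasing sequences with
    values in {0, ..., m}.

    On the other side, type_map flips Q from 1 to 0 and keeps P on the types A
    and B, so the matrix entry of index (i, j) is precisely the strip with
    P k = (k < m - j) and Q k = (i <= k) ([Phi_board]). Thus Phi reads the
    sequences a and b off R and C, and it is a bijection because subtracting i
    from the i-th smallest element turns the m-subsets of {0, ..., 2m - 1} into
    the weakly increasing sequences of length m in {0, ..., m}
    ([shifted_index_mono], [shifted_index_inj], [shifted_index_surj]). *)

Set Implicit Arguments.
Unset Strict Implicit.
Unset Printing Implicit Defensive.

(** * Initial segments of ordinals *)

Section OrdinalPredicates.
Variable m : nat.

(** Attacks compare neighbouring blocks only; this spreads the resulting
    one-step implications to all pairs of blocks of a row or of a column. *)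
Lemma ord_step_le (F : pred 'I_m) :
    (forall i j : 'I_m, j = i.+1 :> nat -> F j -> F i) ->
  forall i j : 'I_m, i <= j -> F j -> F i.
Proof.
move=> stepF i j; move: {2}(j - i) (erefl (j - i)) => d.
elim: d j => [|d IHd] j dE le_ij.
  by have -> : j = i by apply: val_inj => /=; lia.
have ltjm := ltn_ord j.
have lt_pj : j.-1 < m by lia.
move=> Fj; apply: (IHd (Ordinal lt_pj)); rewrite /=; try lia.
by apply: stepF Fj => /=; lia.
Qed.

Lemma card_ord_ltn (n : nat) : n <= m -> #|[set k : 'I_m | k < n]| = n.
Proof.
move=> le_nm; rewrite -sum1_card.
rewrite (eq_bigl (fun k : 'I_m => k < n)); last by move=> k; rewrite inE.
by rewrite -(big_ord_widen m (fun=> 1) le_nm) sum1_card card_ord.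
Qed.

(** This recovers a row of P, or of the negation of Q, from the number of its
    ones, hence the sequences a and b from an arrangement. *)
Lemma lower_setE (F : {set 'I_m}) :
    (forall i j : 'I_m, i <= j -> j \in F -> i \in F) ->
  forall k, (k \in F) = (k < #|F|).
Proof.
move=> downF k; have ltkm := ltn_ord k; apply/idP/idP => [Fk | lt_kF].
  rewrite -[k.+1]card_ord_ltn //; apply/subset_leq_card/subsetP=> i.
  by rewrite inE ltnS => le_ik; apply: downF Fk.
apply: contraLR lt_kF => notFk; rewrite -leqNgt -[X in _ <= X](card_ord_ltn (ltnW ltkm)).
apply/subset_leq_card/subsetP=> i Fi; rewrite inE ltnNge.
by apply: contra notFk => le_ki; apply: downF Fi.
Qed.

Lemma cutoff_inj (a b : nat) :
  a <= m -> b <= m -> (forall k : 'I_m, (k < a) = (k < b)) -> a = b.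
Proof.
move=> le_am le_bm eq_ab; rewrite -(card_ord_ltn le_am) -(card_ord_ltn le_bm).
by congr #|pred_of_set _|; apply/setP=> k; rewrite !inE eq_ab.
Qed.

End OrdinalPredicates.

(** * Arrangements as pairs of boolean matrices *)

Section Blocks.
Variable m : nat.
Implicit Types (s k : 'I_m) (r c : bool) (P Q : 'I_m -> 'I_m -> bool).

Fact block_ord_subproof s r : r + s.*2 < m.*2.
Proof. by have := ltn_ord s; case: r; lia. Qed.

Definition block_ord s r : 'I_m.*2 := Ordinal (block_ord_subproof s r).

Lemma half_block_ord s r : half_ord (block_ord s r) = s.
Proof. by apply: val_inj; rewrite /= half_bit_double. Qed.

Lemma odd_block_ord s r : odd (block_ord s r) = r.
Proof. by rewrite /= oddD odd_double addbF; case: r. Qed.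

Lemma block_ordK (x : 'I_m.*2) : block_ord (half_ord x) (odd x) = x.
Proof. by apply: val_inj; rewrite /= odd_double_half. Qed.

Lemma big_block_ord (F : 'I_m.*2 -> nat) :
  \sum_x F x = \sum_s (F (block_ord s false) + F (block_ord s true)).
Proof.
rewrite (reindex (fun sr : 'I_m * bool => block_ord sr.1 sr.2)) /=.
  rewrite -(pair_bigA _ (fun s r => F (block_ord s r))) /=.
  by apply: eq_bigr => s _; rewrite big_bool addnC.
exists (fun x => (half_ord x, odd x)) => [[s r] _ | x _].
  by congr pair; rewrite ?half_block_ord ?odd_block_ord.
exact: block_ordK.
Qed.

(** The arrangement with one pawn on each diagonal of each block. A cell is on
    the main diagonal of its block when its row and column have the same
    parity; P and Q describe the cells of even row, and the exclusive or
    complements them on the odd rows. *)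
Definition board P Q : arrangement m.*2 m.*2 :=
  [set x : cell m.*2 m.*2 | odd x.1 (+)
     (if odd x.1 == odd x.2 then P else Q) (half_ord x.1) (half_ord x.2)].

Lemma mem_board P Q s k r c :
  ((block_ord s r, block_ord k c) \in board P Q) =
    r (+) (if r == c then P else Q) s k.
Proof. by rewrite inE /fst /snd !half_block_ord !odd_block_ord. Qed.

Definition diag_count (S : arrangement m.*2 m.*2) s k : nat :=
  ((block_ord s false, block_ord k false) \in S) +
  ((block_ord s true, block_ord k true) \in S).

Definition antidiag_count (S : arrangement m.*2 m.*2) s k : nat :=
  ((block_ord s false, block_ord k true) \in S) +
  ((block_ord s true, block_ord k false) \in S).

Lemma card_blocks (S : arrangement m.*2 m.*2) :
  #|S| = \sum_(sk : 'I_m * 'I_m)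
           (diag_count S sk.1 sk.2 + antidiag_count S sk.1 sk.2).
Proof.
transitivity (\sum_(x : cell m.*2 m.*2) (x \in S : nat)).
  by rewrite -sum1_card big_mkcond; apply: eq_bigr => x _; case: (x \in S).
have -> : \sum_(x : cell m.*2 m.*2) (x \in S : nat) =
    \sum_(i : 'I_m.*2) \sum_(j : 'I_m.*2) ((i, j) \in S : nat).
  by rewrite pair_bigA; apply: eq_bigr => -[].
rewrite big_block_ord.
rewrite -(pair_bigA _ (fun s k => diag_count S s k + antidiag_count S s k)) /=.
apply: eq_bigr => s _; rewrite !big_block_ord -big_split /=.
by apply: eq_bigr => k _; rewrite /diag_count /antidiag_count; lia.
Qed.

Lemma sum_two_blocks : \sum_(sk : 'I_m * 'I_m) 2 = 2 * m ^ 2.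
Proof. by rewrite sum_nat_const card_prod card_ord mulnC mulnn. Qed.

Lemma card_board P Q : #|board P Q| = 2 * m ^ 2.
Proof.
rewrite card_blocks -sum_two_blocks; apply: eq_bigr => -[s k] _.
rewrite /diag_count /antidiag_count !mem_board /=.
by case: (P s k); case: (Q s k).
Qed.

Lemma board_inj P Q P' Q' :
  board P Q = board P' Q' -> (P =2 P') * (Q =2 Q').
Proof.
move=> eqB; split=> s k.
  by rewrite -[LHS](mem_board P Q s k false false) eqB mem_board.
by rewrite -[LHS](mem_board P Q s k false true) eqB mem_board.
Qed.

(** Attacking is not symmetric, but the direction faced only decides which of
    two pawns attacks the other, so the condition on a whole arrangement can be
    stated with x in the row just above y for both directions. *)
Lemma nonattackingP d (S : arrangement m.*2 m.*2) :
  reflect (forall x y, x \in S -> y \in S -> y.1 = x.1.+1 :> nat ->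
             (y.2 == x.2.+1 :> nat) || (x.2 == y.2.+1 :> nat) -> False)
          (nonattacking d S).
Proof.
apply: (iffP forall_inP) => [naS x y Sx Sy rowE colE | naS x Sx].
  case: d naS => naS.
    by have /forall_inP/(_ x Sx) := naS y Sy; rewrite /attacks rowE eqxx orbC colE.
  by have /forall_inP/(_ y Sy) := naS x Sx; rewrite /attacks rowE eqxx colE.
apply/forall_inP=> y Sy; apply/negP; case: d => /andP[/eqP rowE colE].
  by apply: (naS y x) => //; rewrite orbC.
exact: (naS x y).
Qed.

(** Diagonally adjacent cells have opposite parities in both coordinates, so
    they lie on diagonals of the same kind: of x and y one is an upper and the
    other a lower cell, hence both are occupied only if P (or Q) takes
    different values on their blocks. The monotonicity of P (or Q), used from x
    to y or from y to x according to the parities, excludes this. *)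
Lemma board_nonattacking d P Q :
    (forall s s' k k', s <= s' -> k <= k' -> P s' k' -> P s k) ->
    (forall s s' k k', s <= s' -> k <= k' -> Q s' k -> Q s k') ->
  nonattacking d (board P Q).
Proof.
move=> monoP monoQ; apply/nonattackingP=> -[x1 x2] [y1 y2].
rewrite !inE /= => Sx Sy rowE colE; move: Sx Sy.
have -> : odd y1 = ~~ odd x1 by rewrite rowE.
have -> : odd y2 = ~~ odd x2 by case/orP: colE => /eqP->; rewrite /= ?negbK.
have := monoP (half_ord x1) (half_ord y1) (half_ord x2) (half_ord y2).
have := monoP (half_ord y1) (half_ord x1) (half_ord y2) (half_ord x2).
have := monoQ (half_ord x1) (half_ord y1) (half_ord y2) (half_ord x2).
have := monoQ (half_ord y1) (half_ord x1) (half_ord x2) (half_ord y2).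
case Er: (odd x1); case Ec: (odd x2) => /=;
  case: (P _ _); case: (P _ _); case: (Q _ _); case: (Q _ _) => //=; lia.
Qed.

(** Across the edge between two neighbouring blocks there is one attacking pair
    of cells on main diagonals and one on antidiagonals; the first pair gives
    the one-step implication for P, the second the one for Q. *)
Lemma board_mono d P Q : nonattacking d (board P Q) ->
     (forall s s' k k', s <= s' -> k <= k' -> P s' k' -> P s k)
  /\ (forall s s' k k', s <= s' -> k <= k' -> Q s' k -> Q s k').
Proof.
move/nonattackingP=> naB.
have clash s k r c s' k' r' c' :
    block_ord s' r' = (block_ord s r).+1 :> nat ->
    (block_ord k' c' == (block_ord k c).+1 :> nat)
      || (block_ord k c == (block_ord k' c').+1 :> nat) ->
    r (+) (if r == c then P else Q) s k ->
    r' (+) (if r' == c' then P else Q) s' k' -> False.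
  move=> rowE colE; rewrite -!mem_board => Bx By; exact: naB Bx By rowE colE.
split=> s s' k k' le_s le_k.
- suff Pcol: P s' k' -> P s' k.
    move/Pcol; apply: (@ord_step_le _ (P^~ k)) le_s => i j ij Pj.
    by apply: contraT => nPi; case: (@clash i k true true j k false false) => //=; lia.
  apply: (@ord_step_le _ (P s')) le_k => i j ij Pj.
  by apply: contraT => nPi; case: (@clash s' j false false s' i true true) => //=; lia.
- suff Qcol: Q s' k -> Q s' k'.
    move/Qcol; apply: (@ord_step_le _ (Q^~ k')) le_s => i j ij Qj.
    by apply: contraT => nQi; case: (@clash i k' true false j k' false true) => //=; lia.
  apply: contraTT; apply: (@ord_step_le _ (fun k => ~~ Q s' k)) le_k => i j ij.
  apply: contra => Qi; apply: contraT => nQj.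
  by case: (@clash s' i false true s' j true false) => //=; lia.
Qed.

(** Pigeonhole: each of the 2 m^2 block diagonals carries at most one pawn, and
    there are 2 m^2 pawns. *)
Lemma max_nonattacking_board d (S : arrangement m.*2 m.*2) :
  S \in calB d m -> exists P Q, S = board P Q.
Proof.
rewrite inE => /andP[/nonattackingP naS /eqP cardS].
have le1 s k : diag_count S s k <= 1 /\ antidiag_count S s k <= 1.
  split; rewrite /diag_count /antidiag_count;
    case Sx: (_ \in S); case Sy: (_ \in S) => //.
    by case: (naS _ _ Sx Sy) => //=; lia.
  by case: (naS _ _ Sx Sy) => //=; lia.
have eq1 s k : diag_count S s k = 1 /\ antidiag_count S s k = 1.
  have le2 (sk : 'I_m * 'I_m) : true ->
      diag_count S sk.1 sk.2 + antidiag_count S sk.1 sk.2 <= 2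
        ?= iff (diag_count S sk.1 sk.2 + antidiag_count S sk.1 sk.2 == 2).
    by have [] := le1 sk.1 sk.2; split => //; lia.
  (* The bound 2 per block is attained in total, hence in each block. *)
  have [_] := leqif_sum le2; rewrite -card_blocks sum_two_blocks cardS eqxx.
  by move/esym/forall_inP/(_ (s, k) isT) => /=; have [] := le1 s k; lia.
exists (fun s k => (block_ord s false, block_ord k false) \in S).
exists (fun s k => (block_ord s false, block_ord k true) \in S).
apply/setP=> -[x1 x2]; rewrite -(block_ordK x1) -(block_ordK x2) mem_board.
have [] := eq1 (half_ord x1) (half_ord x2); rewrite /diag_count /antidiag_count.
by case: (odd x1); case: (odd x2) => /=; do ![case: (_ \in S) => //=].
Qed.

End Blocks.

(** * Increasing enumerations of subsets *)

Section Subsets.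
Variables (m n : nat).
Implicit Type R : {set 'I_n}.

Lemma sorted_val_enum R : sorted ltn [seq val r | r <- enum R].
Proof.
apply: (subseq_sorted ltn_trans (s2 := [seq val r | r <- enum 'I_n])).
  by apply: map_subseq; rewrite (enumT 'I_n); exact: filter_subseq.
by rewrite val_enum_ord iota_ltn_sorted.
Qed.

Lemma mem_val_enum R (x : 'I_n) : (val x \in [seq val r | r <- enum R]) = (x \in R).
Proof. by rewrite (mem_map val_inj) mem_enum. Qed.

Lemma nth_elt_lt R i j : i < j < #|R| -> nth_elt R i < nth_elt R j.
Proof.
case/andP=> lt_ij lt_jR; have := sorted_val_enum R.
move/(sorted_ltn_nth ltn_trans 0); apply => //; rewrite inE size_map -cardE //.
exact: ltn_trans lt_jR.
Qed.

Lemma nth_elt_ltn R i : i < #|R| -> nth_elt R i < n.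
Proof.
move=> lt_iR; rewrite /nth_elt.
have : nth 0 [seq val r | r <- enum R] i \in [seq val r | r <- enum R].
  by rewrite mem_nth // size_map -cardE.
by case/mapP=> r _ ->; exact: ltn_ord.
Qed.

(** Elements of an increasing sequence of integers are at least as far apart as
    their positions; this is what makes r_i - i weakly increasing. *)
Lemma nth_elt_gap R i j : i <= j < #|R| -> nth_elt R i + (j - i) <= nth_elt R j.
Proof.
elim: j => [|j IHj] /andP[le_ij lt_jR].
  by move: le_ij; rewrite leqn0 => /eqP->; rewrite addn0.
have [->|ne_ij] := eqVneq i j.+1; first by rewrite subnn addn0.
have := IHj; have := @nth_elt_lt R j j.+1; lia.
Qed.

Lemma nth_elt_inj R R' :
    #|R| = #|R'| -> (forall i, i < #|R| -> nth_elt R i = nth_elt R' i) -> R = R'.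
Proof.
move=> eq_card eqRR'; apply/setP=> x; rewrite -!mem_val_enum.
congr (_ \in _); apply: (@eq_from_nth _ 0); rewrite !size_map -!cardE //.
Qed.

End Subsets.

(** * Subsets of size m and weakly increasing sequences *)

Section ShiftedIndex.
Variable m : nat.
Implicit Types (R : {set 'I_m.*2}) (i j : 'I_m).

(** Neither the truncated subtraction nor [inord] loses information: counting
    from the first element, r_i is at least i, and counting from the last one,
    r_i is at most 2m - 1 - (m - 1 - i) = m + i. *)
Lemma nth_elt_shift R i : #|R| = m -> nth_elt R i = shifted_index R i + i.
Proof.
move=> cardR; have ltim := ltn_ord i.
have := @nth_elt_gap _ R 0 i; have := @nth_elt_gap _ R i m.-1.
have := @nth_elt_ltn _ R m.-1; rewrite cardR /shifted_index => lt le0 le1.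
by rewrite inordK; lia.
Qed.

Lemma shifted_index_mono R i j :
  #|R| = m -> i <= j -> shifted_index R i <= shifted_index R j.
Proof.
move=> cardR le_ij; have := @nth_elt_gap _ R i j.
by rewrite !nth_elt_shift // cardR; have := ltn_ord j; lia.
Qed.

Lemma shifted_index_inj R R' : #|R| = m -> #|R'| = m ->
  (forall i, shifted_index R i = shifted_index R' i :> nat) -> R = R'.
Proof.
move=> cardR cardR' eqRR'; apply: nth_elt_inj; rewrite cardR ?cardR' // => i lt_im.
by rewrite (nth_elt_shift (Ordinal lt_im) cardR) eqRR' -nth_elt_shift.
Qed.

(** The sequence a comes from the set of the values a i + i, which are strictly
    increasing in i and hence its elements in increasing order. *)
Lemma shifted_index_surj (a : 'I_m -> nat) :
    (forall i, a i <= m) -> (forall i j, i <= j -> a i <= a j) ->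
  exists2 R : {set 'I_m.*2}, #|R| = m & forall i, shifted_index R i = a i :> nat.
Proof.
move=> a_le a_mono.
have lt_e i : a i + i < m.*2 by have := a_le i; have := ltn_ord i; lia.
pose e i := Ordinal (lt_e i); pose R := [set e i | i in 'I_m].
have e_inj : injective e.
  move=> i j /(congr1 val) /= eq_ij; apply: ord_inj.
  have := a_mono i j; have := a_mono j i; lia.
have cardR : #|R| = m by rewrite card_imset ?card_ord.
exists R => // i; apply: (@addIn i); rewrite -nth_elt_shift //.
(* Two strictly sorted sequences with the same elements are equal. *)
have enumR : [seq val r | r <- enum R] = [seq val (e i) | i <- enum 'I_m].
  apply: (irr_sorted_eq ltn_trans ltnn); first exact: sorted_val_enum.
    rewrite sorted_map.
    have : sorted ltn (map val (enum 'I_m)) by rewrite val_enum_ord iota_ltn_sorted.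
    rewrite sorted_map; apply: sub_sorted => j k /= lt_jk.
    by have := a_mono j k; rewrite /relpre /=; lia.
  move=> x; apply/mapP/mapP=> [[r] | [j _ ->]].
    by rewrite mem_enum => /imsetP[j _ ->] ->; exists j; rewrite ?mem_enum.
  by exists (e j); rewrite // mem_enum imset_f.
by rewrite /nth_elt enumR (nth_map i) ?size_enum_ord ?nth_ord_enum.
Qed.

End ShiftedIndex.

(** * The bijection *)

(** The 0-based formula for Phi in the boolean encoding: the second index of
    the matrix entry controls P alone, and the first index Q alone. *)
Lemma Phi_board m (RC : {set 'I_m.*2} * {set 'I_m.*2}) :
  Phi RC = board (fun s k : 'I_m => k < m - shifted_index RC.2 s)
                 (fun s k => shifted_index RC.1 s <= k).
Proof.
apply/setP=> -[x1 x2]; rewrite !inE mxE inE /entry_types /first_row_types /=.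
rewrite (fun_if (fun F => F (half_ord x1) (half_ord x2))) /= (leqNgt _ x2./2).
case: (_ < _); case: (_ < _); rewrite inE /= !modn2.
all: by case: (odd x1); case: (odd x2).
Qed.

Theorem corollary2p8 (d : facing) (m : nat) (hm : 1 <= m) :
  [/\ forall RC, RC \in calA m -> Phi RC \in calB d m,
      {in calA m &, injective (@Phi m)}
    & forall S, S \in calB d m -> exists2 RC, RC \in calA m & Phi RC = S].
Proof.
split=> [[R C] | [R C] [R' C'] | S BS].
- rewrite !inE /= => /andP[/eqP cardR /eqP cardC].
  rewrite Phi_board card_board eqxx andbT; apply: board_nonattacking => s s' k k' le_s.
    by have := shifted_index_mono cardC le_s; rewrite /=; lia.
  by have := shifted_index_mono cardR le_s; rewrite /=; lia.
- rewrite !inE /= => /andP[/eqP cardR /eqP cardC] /andP[/eqP cardR' /eqP cardC'].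
  rewrite !Phi_board => /board_inj[/= eqP eqQ].
  have le_m (X : {set 'I_m.*2}) i : shifted_index X i <= m by rewrite -ltnS.
  congr pair; apply: shifted_index_inj => // i.
    by apply: (@cutoff_inj m) => // k; rewrite !ltnNge eqQ.
  have := le_m C i; have := le_m C' i.
  by have := @cutoff_inj m _ _ (leq_subr _ _) (leq_subr _ _) (eqP i); lia.
have [P [Q defS]] := max_nonattacking_board BS.
have := BS; rewrite inE defS => /andP[/board_mono[monoP monoQ] _].
have lowerP s k : P s k = (k < #|[set k | P s k]|).
  by rewrite -lower_setE ?inE // => i j le_ij; rewrite !inE; apply: monoP.
have lowerQ s k : ~~ Q s k = (k < #|[set k | ~~ Q s k]|).
  by rewrite -lower_setE ?inE // => i j le_ij; rewrite !inE; apply: contra; apply: monoQ.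
have le_m (X : {set 'I_m}) : #|X| <= m by rewrite -[m in _ <= m]card_ord max_card.
have [||R cardR shiftR] := @shifted_index_surj m (fun s => #|[set k | ~~ Q s k]|).
- by move=> s; apply: le_m.
- move=> s s' le_s; apply/subset_leq_card/subsetP=> k; rewrite !inE.
  by apply: contra; apply: monoQ.
have [||C cardC shiftC] := @shifted_index_surj m (fun s => m - #|[set k | P s k]|).
- by move=> s; apply: leq_subr.
- move=> s s' le_s; apply: leq_sub2l; apply/subset_leq_card/subsetP=> k; rewrite !inE.
  exact: monoP.
exists (R, C); first by rewrite inE /= cardR cardC !eqxx.
rewrite Phi_board; apply/setP=> x; rewrite !inE; congr (_ (+) _).
case: ifP => _ /=; first by rewrite shiftC subKn // -lowerP.
by rewrite shiftR leqNgt -(lowerQ _ (half_ord x.2)) negbK.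
Qed.
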